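(* Let $F$ be a field of characteristic $0$ that is a splitting field for $S_6$, and let $\mathcal{R}_F(S_6)=F\otimes_{\mathbb{Z}}\mathcal{R}(S_6)$. Write $x_i=[V_{i+1}]$ for $1\le i\le 10$ and $1=[V_1]$, where $V_1,\dots,V_{11}$ are the irreducible complex representations of $S_6$ numbered by the character table given in the context. The regular representation of $\mathcal{R}_F(S_6)$ decomposes as the direct sum of the eleven one-dimensional subrepresentations $F\alpha_1,\dots,F\alpha_{11}$, where \begin{align*} &\alpha_1=1+x_1+5x_2+5x_3+9x_4+9x_5+10x_6+10x_7+5x_8+5x_9+16x_{10},\\ &\alpha_2=1-x_1+3x_2-3x_3+3x_4-3x_5+2x_6-2x_7+x_8-x_9,\\ &\alpha_3=1-x_1-x_6+x_7+x_8-x_9,\\ &\alpha_4=1-x_1-x_2+x_3+3x_4-3x_5-2x_6+2x_7-3x_8+3x_9,\\ &\alpha_5=1-x_1+x_2-x_3-x_4+x_5-x_8+x_9,\\ &\alpha_6=1-x_1-x_2+x_3+x_6-x_7,\\ &\alpha_7=1+x_1+x_2+x_3+x_4+x_5-2x_6-2x_7+x_8+x_9,\\ &\alpha_8=1+x_1+2x_2+2x_3+x_6+x_7-x_8-x_9-2x_{10},\\ &\alpha_9=1+x_1-x_4-x_5+x_{10},\\ &\alpha_{10}=1+x_1-x_2-x_3+x_4+x_5-x_8-x_9,\\ &\alpha_{11}=1+x_1-x_2-x_3+x_6+x_7+2x_8+2x_9-2x_{10}. \end{align*} Consequently, $\mathcal{R}_F(S_6)$ has the following central primitive idempotents: $$e_1=\tfrac{1}{720}\alpha_1,\quad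 e_2=\tfrac{1}{48}\alpha_2,\quad e_3=\tfrac{1}{6}\alpha_3,\quad e_4=\tfrac{1}{48}\alpha_4,\quad e_5=\tfrac{1}{8}\alpha_5,\quad e_6=\tfrac{1}{6}\alpha_6,$$ $$e_7=\tfrac{1}{16}\alpha_7,\quad e_8=\tfrac{1}{18}\alpha_8,\quad e_9=\tfrac{1}{5}\alpha_9,\quad e_{10}=\tfrac{1}{8}\alpha_{10},\quad e_{11}=\tfrac{1}{18}\alpha_{11}.$$
   Context: For a finite group $G$ with irreducible complex representations $V_1,\dots,V_s$ (up to isomorphism), the representation ring $\mathcal{R}(G)$ is the unital commutative ring with $\mathbb{Z}$-basis $[V_1],\dots,[V_s]$ whose operations are determined by $[M]+[N]=[M\oplus N]$ and $[M]\cdot[N]=[M\otimes N]$ for finite-dimensional complex representations $M,N$ of $G$, where $[M]$ is the isomorphism class of $M$. The irreducible complex representation $V_i$ of $S_6$ is the one with character $\chi_i$ in the following table, where the columns are the conjugacy classes of $g_1,\dots,g_{11}$ with the given cycle types and sizes. $$\begin{array}{c|ccccccccccc} & g_1&g_2&g_3&g_4&g_5&g_6&g_7&g_8&g_9&g_{10}&g_{11}\\ \text{cycle type} & 1^6 & 2\,1^4 & 3\,2\,1 & 2^3 & 4\,1^2 & 6 & 2^2 1^2 & 3\,1^3 & 5\,1 & 4\,2 & 3^2\\ \text{size} & 1&15&120&15&90&120&45&40&144&90&40\\ \hline \chi_1&1&1&1&1&1&1&1&1&1&1&1\\ \chi_2&1&-1&-1&-1&-1&-1&1&1&1&1&1\\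 \chi_3&5&3&0&-1&1&-1&1&2&0&-1&-1\\ \chi_4&5&-3&0&1&-1&1&1&2&0&-1&-1\\ \chi_5&9&3&0&3&-1&0&1&0&-1&1&0\\ \chi_6&9&-3&0&-3&1&0&1&0&-1&1&0\\ \chi_7&10&2&-1&-2&0&1&-2&1&0&0&1\\ \chi_8&10&-2&1&2&0&-1&-2&1&0&0&1\\ \chi_9&5&1&1&-3&-1&0&1&-1&0&-1&2\\ \chi_{10}&5&-1&-1&3&1&0&1&-1&0&-1&2\\ \chi_{11}&16&0&0&0&0&0&0&-2&1&0&-2 \end{array}$$ *)

(* Defs.v *)
From HB Require Import structures.
From mathcomp Require Import all_boot all_order all_algebra all_fingroup.
From mathcomp Require Import all_solvable all_field all_character.
From mathcomp Require Import reals complex.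

Set Implicit Arguments.
Unset Strict Implicit.
Unset Printing Implicit Defensive.

Import Order.TTheory GRing.Theory Num.Theory.
Local Open Scope ring_scope.

Section Multiplicities.

Variables (C : numClosedFieldType) (gT : finGroupType) (G : {group gT}).

(* Indexes the irreducible representations of G over C, one per isomorphism
   class: irr_repr i is the irreducible representation of index i. *)
Definition irrep : irrType C G := DecSocleType (regular_repr C G).

(* The multiplicity of irr_repr i in rG. The sum ranges over the isotypic
   components of rG, at most one of which is of type i. *)
Definition repr_mult n (rG : mx_representation C G n) (i : irrep) : nat :=
  \sum_(W : DecSocleType rG | irr_comp irrep (socle_repr W) == i) socle_mult W.

Lemma trivial_mx_repr : mx_repr G (fun _ : gT => 1%:M : 'M[C]_1).
Proof. by split=> // x y _ _; rewrite mulmx1. Qed.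
Definition trivial_repr := MxRepresentation trivial_mx_repr.

Let C'G : ([pchar C]^'.-group G)%g.
Proof. by apply/pgroupP=> p _ _; rewrite inE /= pchar_num. Qed.

Lemma mxtrace_repr_mult n (rG : mx_representation C G n) x : x \in G ->
  \tr (rG x) = \sum_i (repr_mult rG i)%:R * \tr (irr_repr i x).
Proof.
move=> Gx; pose sG : socleType rG := DecSocleType rG.
have S1 : Socle sG = 1%:M := reducible_Socle1 sG (mx_Maschke_pchar rG C'G).
have rS : mx_rsim (submod_repr (Socle_module sG)) rG.
  by apply: rsim_submod1; rewrite S1.
rewrite -(mxtrace_rsim rS Gx) (mxtrace_Socle sG) //.
rewrite (partition_big (fun W : sG => irr_comp irrep (socle_repr W)) xpredT) //.
apply: eq_bigr => i _; rewrite natr_sum mulr_suml; apply: eq_bigr => W /eqP <-.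
rewrite mulr_natl; congr (_ *+ _); apply: mxtrace_rsim Gx.
exact: rsim_irr_comp_pchar (socle_irr W).
Qed.

Lemma irr_chi_free (f g : irrep -> C) :
  {in G, forall x, \sum_i f i * \tr (irr_repr i x)
                 = \sum_i g i * \tr (irr_repr i x)} -> f =1 g.
Proof.
move=> eq_fg j; pose e := Wedderburn_id j.
have /envelop_mxP[a De] : (e \in enveloping_algebra_mx (regular_repr C G))%MS.
  rewrite -(Wedderburn_sum_pchar irrep C'G).
  by rewrite (sumsmx_sup j) ?Wedderburn_id_mem.
have tr_e i : \tr (gring_op (irr_repr i) e)
    = \sum_(x in G) a x * \tr (irr_repr i x).
  rewrite De !linear_sum; apply: eq_bigr => x Gx.
  by rewrite /= 2!linearZ /= gring_opG.
have expand (h : irrep -> C) :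
    \sum_(x in G) a x * (\sum_i h i * \tr (irr_repr i x))
  = h j * (irr_degree j)%:R.
  under eq_bigr do rewrite mulr_sumr.
  rewrite exchange_big /= (bigD1 j) //= [X in _ + X]big1 ?addr0 => [|i ne_ij].
    under eq_bigr do rewrite mulrCA.
    by rewrite -mulr_sumr -tr_e (op_Wedderburn_id_pchar C'G) mxtrace1.
  under eq_bigr do rewrite mulrCA.
  rewrite -mulr_sumr -tr_e (irr_repr'_op0_pchar C'G (j:=j)) ?mxtrace0 ?mulr0 //.
    by rewrite eq_sym.
  exact: Wedderburn_id_mem.
have nz : (irr_degree j)%:R != 0 :> C by rewrite pnatr_eq0 -lt0n irr_degree_gt0.
apply: (mulIf nz); rewrite -!expand.
by apply: eq_bigr => x Gx; rewrite eq_fg.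
Qed.

Lemma repr_mult_uniq n (rG : mx_representation C G n) (m : irrep -> nat) :
    {in G, forall x, \tr (rG x) = \sum_i (m i)%:R * \tr (irr_repr i x)} ->
  repr_mult rG =1 m.
Proof.
move=> Dm i; apply/eqP; rewrite -(eqr_nat C); apply/eqP.
move: i; apply: irr_chi_free => x Gx.
by rewrite -mxtrace_repr_mult // Dm.
Qed.

Lemma repr_mult_irr i j : repr_mult (irr_repr i) j = (i == j).
Proof.
move: j; apply: repr_mult_uniq => x Gx.
rewrite (bigD1 i) //= eqxx mul1r big1 ?addr0 // => j ne_ji.
by rewrite eq_sym (negPf ne_ji) mul0r.
Qed.

Lemma repr_mult_rsim n1 n2 (rG1 : mx_representation C G n1)
    (rG2 : mx_representation C G n2) :
  mx_rsim rG1 rG2 -> repr_mult rG1 =1 repr_mult rG2.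
Proof.
move=> sim12; apply: repr_mult_uniq => x Gx.
by rewrite (mxtrace_rsim sim12 Gx) mxtrace_repr_mult.
Qed.

Lemma repr_mult_dadd (rG1 rG2 : representation C G) i :
  repr_mult (dadd_grepr rG1 rG2) i = (repr_mult rG1 i + repr_mult rG2 i)%N.
Proof.
move: i; apply: repr_mult_uniq => x Gx.
rewrite mxtrace_block !mxtrace_repr_mult // -big_split /=.
by apply: eq_bigr => i _; rewrite natrD mulrDl.
Qed.

Lemma repr_mult_prod n1 n2 (rG1 : mx_representation C G n1)
    (rG2 : mx_representation C G n2) k :
  repr_mult (prod_repr rG1 rG2) k =
    (\sum_i \sum_j repr_mult rG1 i * repr_mult rG2 j
                   * repr_mult (prod_repr (irr_repr i) (irr_repr j)) k)%N.
Proof.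
move: k; apply: repr_mult_uniq => x Gx.
rewrite mxtrace_prod (mxtrace_repr_mult rG1) // (mxtrace_repr_mult rG2) //.
under [RHS]eq_bigr do rewrite natr_sum mulr_suml.
rewrite exchange_big mulr_suml; apply: eq_bigr => i _ /=.
under [RHS]eq_bigr do rewrite natr_sum mulr_suml.
rewrite exchange_big mulr_sumr; apply: eq_bigr => j _ /=.
under [RHS]eq_bigr do rewrite !natrM -mulrA.
by rewrite -mulr_sumr -mxtrace_repr_mult // mxtrace_prod mulrACA.
Qed.

Lemma repr_mult_prodC n1 n2 (rG1 : mx_representation C G n1)
    (rG2 : mx_representation C G n2) :
  repr_mult (prod_repr rG1 rG2) =1 repr_mult (prod_repr rG2 rG1).
Proof.
apply: repr_mult_uniq => x Gx.
by rewrite -mxtrace_repr_mult //= !mxtrace_prod mulrC.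
Qed.

Lemma repr_mult_prodA n1 n2 n3 (rG1 : mx_representation C G n1)
    (rG2 : mx_representation C G n2) (rG3 : mx_representation C G n3) :
  repr_mult (prod_repr rG1 (prod_repr rG2 rG3))
  =1 repr_mult (prod_repr (prod_repr rG1 rG2) rG3).
Proof.
apply: repr_mult_uniq => x Gx.
by rewrite -mxtrace_repr_mult //= !mxtrace_prod mulrA.
Qed.

Lemma repr_mult_prod1 n (rG : mx_representation C G n) :
  repr_mult (prod_repr trivial_repr rG) =1 repr_mult rG.
Proof.
apply: repr_mult_uniq => x Gx.
by rewrite -mxtrace_repr_mult //= mxtrace_prod mxtrace1 mul1r.
Qed.

Lemma repr_mult_trivial : exists i, repr_mult trivial_repr i = 1%N.
Proof.
exists [1 irrep]%irr.
rewrite (repr_mult_uniq (m := fun i => (i == [1 irrep]%irr))) ?eqxx //.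
move=> x Gx; rewrite mxtrace1 (bigD1 [1 irrep]%irr) //= eqxx mul1r.
rewrite big1 ?addr0 => [|i /negPf->]; last by rewrite mul0r.
by rewrite irr1_repr // mxtrace1 degree_irr1.
Qed.

End Multiplicities.

(* K (x)_Z R(G), where R(G) is the representation ring of G: an element is the
   family of its coordinates on the K-basis of the classes of the irreducible
   representations. R(G) itself is repr_ring C G int. *)
Definition repr_ring (C : numClosedFieldType) (gT : finGroupType)
  (G : {group gT}) (K : comNzRingType) := {ffun irrep C G -> K^o}.

Section ReprRing.

Variables (C : numClosedFieldType) (gT : finGroupType) (G : {group gT}).
Variable K : comNzRingType.
Local Notation RK := (repr_ring C G K).

HB.instance Definition _ := GRing.Lmodule.on RK.

(* [M], for M the representation rG. *)
Definition repr_ring_class n (rG : mx_representation C G n) : RK :=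
  [ffun i => (repr_mult rG i)%:R].

(* The K-bilinear extension of [V_i] * [V_j] = [V_i (x) V_j]. *)
Definition repr_ring_mul (x y : RK) : RK :=
  \sum_i \sum_j
    (x i * y j) *: repr_ring_class (prod_repr (irr_repr i) (irr_repr j)).

Definition repr_ring_one : RK := repr_ring_class (trivial_repr C G).

Let N (i j k : irrep C G) : nat :=
  repr_mult (prod_repr (irr_repr i) (irr_repr j)) k.

Let mulE x y k :
  repr_ring_mul x y k = \sum_i \sum_j x i * y j * (N i j k)%:R :> K.
Proof.
rewrite sum_ffunE; apply: eq_bigr => i _; rewrite sum_ffunE.
by apply: eq_bigr => j _; rewrite !ffunE.
Qed.

Let NC (i j k : irrep C G) : N i j k = N j i k.
Proof. exact: repr_mult_prodC. Qed.

Let NA (i j l m : irrep C G) :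
  (\sum_k N j l k * N i k m = \sum_k N i j k * N k l m)%N.
Proof.
have := repr_mult_prodA (irr_repr i) (irr_repr j) (irr_repr l) m.
rewrite !(repr_mult_prod _ (prod_repr _ _)) (repr_mult_prod (prod_repr _ _)).
rewrite (bigD1 i) //= [X in (_ + X)%N]big1 => [|i' ne_i]; last first.
  rewrite big1 // => k _.
  by rewrite repr_mult_irr eq_sym (negPf ne_i) !mul0n.
rewrite addn0 => eqN; transitivity (\sum_k N i j k * (l == l) * N k l m)%N.
  transitivity (\sum_k (i == i) * N j l k * N i k m)%N.
    by apply: eq_bigr => k _; rewrite eqxx mul1n.
  under eq_bigr do rewrite -repr_mult_irr.
  rewrite eqN; apply: eq_bigr => k _.
  rewrite (bigD1 l) //= big1 ?addn0 ?repr_mult_irr // => l' ne_l.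
  by rewrite repr_mult_irr eq_sym (negPf ne_l) muln0.
by apply: eq_bigr => k _; rewrite eqxx muln1.
Qed.

Fact repr_ring_mulC : commutative repr_ring_mul.
Proof.
move=> x y; apply/ffunP=> k; rewrite !mulE exchange_big.
by apply: eq_bigr => j _; apply: eq_bigr => i _; rewrite NC (mulrC (x i)).
Qed.

Fact repr_ring_mulA : associative repr_ring_mul.
Proof.
move=> x y z; apply/ffunP=> m; rewrite !mulE.
transitivity (\sum_i \sum_j \sum_l
    x i * y j * z l * (\sum_k N j l k * N i k m)%N%:R).
  apply: eq_bigr => i _.
  under eq_bigr do rewrite mulE mulr_sumr mulr_suml.
  rewrite exchange_big; apply: eq_bigr => j _ /=.
  under eq_bigr do rewrite mulr_sumr mulr_suml.
  rewrite exchange_big; apply: eq_bigr => l _ /=.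
  rewrite natr_sum mulr_sumr; apply: eq_bigr => k _.
  by rewrite natrM !mulrA.
under eq_bigr do under eq_bigr do under eq_bigr do rewrite NA.
under [RHS]eq_bigr do under eq_bigr do rewrite mulE !mulr_suml.
under [RHS]eq_bigr do rewrite exchange_big.
rewrite [RHS]exchange_big; apply: eq_bigr => i _ /=.
under [RHS]eq_bigr do under eq_bigr do rewrite !mulr_suml.
under [RHS]eq_bigr do rewrite exchange_big.
rewrite [RHS]exchange_big; apply: eq_bigr => j _ /=.
rewrite [RHS]exchange_big; apply: eq_bigr => l _ /=.
rewrite natr_sum mulr_sumr; apply: eq_bigr => k _.
by rewrite natrM mulrA (mulrAC _ (z l)).
Qed.

Fact repr_ring_mul1 : left_id repr_ring_one repr_ring_mul.
Proof.
move=> x; apply/ffunP=> k; rewrite mulE exchange_big.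
have N1 j : (\sum_i repr_mult (trivial_repr C G) i * N i j k)%N = (j == k).
  rewrite -repr_mult_irr -repr_mult_prod1 repr_mult_prod.
  apply: eq_bigr => i _; rewrite (bigD1 j) //= big1 ?addn0.
    by rewrite repr_mult_irr eqxx muln1.
  by move=> l ne_l; rewrite repr_mult_irr eq_sym (negPf ne_l) muln0.
transitivity (\sum_j x j * (j == k)%:R : K); last first.
  rewrite (bigD1 k) //= eqxx mulr1 big1 ?addr0 // => j /negPf->.
  by rewrite mulr0.
apply: eq_bigr => j _; rewrite -N1 natr_sum mulr_sumr.
by apply: eq_bigr => i _; rewrite ffunE natrM mulrA (mulrC (x j)).
Qed.

Fact repr_ring_mulDl : left_distributive repr_ring_mul +%R.
Proof.
move=> x y z; apply/ffunP=> k; rewrite ffunE !mulE -big_split.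
apply: eq_bigr => i _; rewrite -big_split; apply: eq_bigr => j _.
by rewrite ffunE !mulrDl.
Qed.

Fact repr_ring_one_neq0 : repr_ring_one != 0.
Proof.
have [i i1] := repr_mult_trivial C G.
by apply/eqP=> /ffunP/(_ i)/eqP; rewrite !ffunE i1 oner_eq0.
Qed.

HB.instance Definition _ := GRing.Zmodule_isComNzRing.Build RK
  repr_ring_mulA repr_ring_mulC repr_ring_mul1 repr_ring_mulDl
  repr_ring_one_neq0.

Fact repr_ring_scalerAl (a : K) (x y : RK) : a *: (x * y) = (a *: x) * y.
Proof.
apply/ffunP=> k; rewrite ffunE !mulE scaler_sumr; apply: eq_bigr => i _.
rewrite scaler_sumr; apply: eq_bigr => j _.
by rewrite ffunE /GRing.scale /= !mulrA.
Qed.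

HB.instance Definition _ :=
  GRing.Lmodule_isLalgebra.Build K RK repr_ring_scalerAl.
HB.instance Definition _ := GRing.Lalgebra_isComAlgebra.Build K RK.

Lemma repr_ring_class_rsim n1 n2 (rG1 : mx_representation C G n1)
    (rG2 : mx_representation C G n2) :
  mx_rsim rG1 rG2 -> repr_ring_class rG1 = repr_ring_class rG2.
Proof. by move=> s12; apply/ffunP=> i; rewrite !ffunE (repr_mult_rsim s12). Qed.

Lemma repr_ring_class_dadd (rG1 rG2 : representation C G) :
  repr_ring_class (dadd_grepr rG1 rG2) =
    repr_ring_class rG1 + repr_ring_class rG2.
Proof. by apply/ffunP=> i; rewrite !ffunE repr_mult_dadd natrD. Qed.

Lemma repr_ring_class_prod n1 n2 (rG1 : mx_representation C G n1)
    (rG2 : mx_representation C G n2) :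
  repr_ring_class (prod_repr rG1 rG2) =
    repr_ring_class rG1 * repr_ring_class rG2.
Proof.
apply/ffunP=> k; rewrite mulE ffunE repr_mult_prod natr_sum.
apply: eq_bigr => i _; rewrite natr_sum; apply: eq_bigr => j _.
by rewrite !ffunE !natrM.
Qed.

Lemma repr_ring_class_trivial : repr_ring_class (trivial_repr C G) = 1.
Proof. by []. Qed.

Lemma repr_ring_basis (x : RK) : x = \sum_i x i *: repr_ring_class (irr_repr i).
Proof.
apply/ffunP=> k; rewrite sum_ffunE (bigD1 k) //= big1 ?addr0 => [|i ne_ik].
  by rewrite !ffunE repr_mult_irr eqxx /GRing.scale /= mulr1.
by rewrite !ffunE repr_mult_irr (negPf ne_ik) scaler0.
Qed.

End ReprRing.
Arguments repr_ring_class {C gT G} K {n} rG.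

HB.instance Definition _ (C : numClosedFieldType) (gT : finGroupType)
    (G : {group gT}) (K : fieldType) :=
  SemiVector.copy (repr_ring C G K) {ffun irrep C G -> K^o}.
HB.instance Definition _ (C : numClosedFieldType) (gT : finGroupType)
    (G : {group gT}) (K : fieldType) :=
  Algebra_isFalgebra.Build K (repr_ring C G K).

(* repr_ring C G K, with the ring morphism x |-> 1 (x) x below, has the
   universal property of K (x)_Z R(G). *)
Section ScalarExtension.

Variables (C : numClosedFieldType) (gT : finGroupType) (G : {group gT}).
Variable K : comNzRingType.
Local Notation RZ := (repr_ring C G int).
Local Notation RK := (repr_ring C G K).

Definition repr_ring_extend (x : RZ) : RK := [ffun i => (x i)%:~R].

Lemma repr_ring_extend_class n (rG : mx_representation C G n) :
  repr_ring_extend (repr_ring_class int rG) = repr_ring_class K rG.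
Proof. by apply/ffunP=> i; rewrite !ffunE natz. Qed.

Fact repr_ring_extend_zmod : zmod_morphism repr_ring_extend.
Proof. by move=> x y; apply/ffunP=> i; rewrite !ffunE rmorphB. Qed.
HB.instance Definition _ :=
  GRing.isZmodMorphism.Build RZ RK repr_ring_extend repr_ring_extend_zmod.

Let extendZ (a : int) (x : RZ) :
  repr_ring_extend (a *: x) = a%:~R *: repr_ring_extend x.
Proof. by apply/ffunP=> i; rewrite !ffunE rmorphM. Qed.

Fact repr_ring_extend_monoid : monoid_morphism repr_ring_extend.
Proof.
split=> [|x y]; first exact: repr_ring_extend_class.
rewrite [LHS]raddf_sum; apply: eq_bigr => i _.
rewrite raddf_sum; apply: eq_bigr => j _.
by rewrite /= extendZ repr_ring_extend_class !ffunE rmorphM.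
Qed.
HB.instance Definition _ :=
  GRing.isMonoidMorphism.Build RZ RK repr_ring_extend repr_ring_extend_monoid.

Lemma repr_ring_extend_exists (M : lmodType K) (f : {additive RZ -> M}) :
  exists g : {linear RK -> M}, forall x, g (repr_ring_extend x) = f x.
Proof.
pose g (x : RK) : M := \sum_i (x i : K) *: f (repr_ring_class int (irr_repr i)).
have g_lin : linear g.
  move=> a x y; rewrite /g scaler_sumr -big_split; apply: eq_bigr => i _.
  by rewrite !ffunE scalerDl scalerA.
pose gL := GRing.isLinear.Build K RK M *:%R g g_lin.
exists (HB.pack_for {linear RK -> M} g gL) => x /=.
rewrite {2}[x]repr_ring_basis raddf_sum; apply: eq_bigr => i _.
have /(congr1 f) -> : x i *: repr_ring_class int (irr_repr i)
    = repr_ring_class int (irr_repr i) *~ x i.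
  by rewrite -scaler_int intz.
by rewrite ffunE scaler_int raddfMz.
Qed.

Lemma repr_ring_extend_uniq (M : lmodType K) (g h : {linear RK -> M}) :
  (forall x, g (repr_ring_extend x) = h (repr_ring_extend x)) -> g =1 h.
Proof.
move=> eq_gh x; rewrite [x]repr_ring_basis !linear_sum.
by apply: eq_bigr => i _; rewrite !linearZ /= -repr_ring_extend_class eq_gh.
Qed.

Lemma repr_ring_extend_morph (A : algType K) (f : {rmorphism RZ -> A})
    (g : {linear RK -> A}) :
  (forall x, g (repr_ring_extend x) = f x) -> monoid_morphism g.
Proof.
move=> Dg; split=> [|x y].
  by rewrite -(rmorph1 repr_ring_extend) Dg rmorph1.
rewrite [x]repr_ring_basis [y]repr_ring_basis mulr_suml !linear_sum mulr_suml.
apply: eq_bigr => i _; rewrite mulr_sumr linear_sum mulr_sumr.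
apply: eq_bigr => j _; rewrite -scalerAl -scalerAr !linearZ /=.
rewrite -scalerAl -scalerAr; congr (_ *: (_ *: _)).
by rewrite -!repr_ring_extend_class -rmorphM !Dg rmorphM.
Qed.

End ScalarExtension.

(* A subrepresentation of the regular representation of A, that is, of A acting
   on itself by multiplication. *)
Definition regular_subrep (K : fieldType) (A : falgType K) (U : {vspace A}) :=
  forall a u : A, u \in U -> a * u \in U.

Definition central_idempotent (A : nzRingType) (e : A) :=
  (forall a : A, e * a = a * e) /\ e * e = e.

Definition central_primitive_idempotent (A : nzRingType) (e : A) :=
  [/\ central_idempotent e, e != 0 &
      forall f g : A, central_idempotent f -> central_idempotent g ->
        f * g = 0 -> e = f + g -> f = 0 \/ g = 0].

(* The parts of the cycle type, fixed points included, in decreasing order. *)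
Definition cycle_type n (s : 'S_n) : seq nat :=
  sort geq [seq #|X| | X : {set 'I_n} in porbits s].

Definition S6_cycle_types : seq (seq nat) :=
  [:: [:: 1; 1; 1; 1; 1; 1];
      [:: 2; 1; 1; 1; 1];
      [:: 3; 2; 1];
      [:: 2; 2; 2];
      [:: 4; 1; 1];
      [:: 6];
      [:: 2; 2; 1; 1];
      [:: 3; 1; 1; 1];
      [:: 5; 1];
      [:: 4; 2];
      [:: 3; 3] ]%N.

(* Columns follow S6_cycle_types. *)
Definition S6_character_table : seq (seq int) :=
  [:: [::  1;  1;  1;  1;  1;  1;  1;  1;  1;  1;  1];
      [::  1; -1; -1; -1; -1; -1;  1;  1;  1;  1;  1];
      [::  5;  3;  0; -1;  1; -1;  1;  2;  0; -1; -1];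
      [::  5; -3;  0;  1; -1;  1;  1;  2;  0; -1; -1];
      [::  9;  3;  0;  3; -1;  0;  1;  0; -1;  1;  0];
      [::  9; -3;  0; -3;  1;  0;  1;  0; -1;  1;  0];
      [:: 10;  2; -1; -2;  0;  1; -2;  1;  0;  0;  1];
      [:: 10; -2;  1;  2;  0; -1; -2;  1;  0;  0;  1];
      [::  5;  1;  1; -3; -1;  0;  1; -1;  0; -1;  2];
      [::  5; -1; -1;  3;  1;  0;  1; -1;  0; -1;  2];
      [:: 16;  0;  0;  0;  0;  0;  0; -2;  1;  0; -2] ].

(* rG affords the character in row i (counted from 0) of the table. *)
Definition affords_S6_row (C : numClosedFieldType) (i : nat) n
    (rG : mx_representation C [set: 'S_6] n) :=
  forall (j : 'I_11) (s : 'S_6), cycle_type s = nth [::] S6_cycle_types j ->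
    \tr (rG s) = (nth 0 (nth [::] S6_character_table i) j)%:~R.

(* Main.v *)
From HB Require Import structures.
Require Import Defs.
From mathcomp Require Import all_boot all_order all_algebra all_fingroup.
From mathcomp Require Import all_solvable all_field all_character.
From mathcomp Require Import reals complex.

(** The theorem is the statement that taking characters diagonalizes the
    representation ring.  For g in a finite group G, the trace of g is additive
    on direct sums and multiplicative on tensor products, so it extends to a
    multiplicative linear form on the representation ring.  A class of S_6 thus
    gives a form chi_j ([char_value], [char_valueM]), whose value at [V_i] is
    the entry (i, j) of the character table.

    The element alpha_j is the sum over i of the entry (i, j) times [V_i]
    ([S6_column_sum]), so chi_k (alpha_j) is the product of the columns j and k
    of the table.  By the second orthogonality relation, checked on the table
    itself ([S6_table_orthogonal]), it vanishes for j distinct from k, and for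
    j = k it is the order of the centralizer of g_j, nonzero in characteristic
    0.  As the ring has dimension 11, the forms chi_j identify it with the
    product of 11 copies of the field, e_j being the j-th unit vector.  The
    section on split algebras draws all the conclusions from this.

    Two facts link the abstract irreducible representations to the table.
    - Every class of the table is inhabited ([S6_class_repr]), because there are
      permutations of every cycle type ([exists_cycle_type]).  Hence distinct
      rows are afforded by non-isomorphic representations, and the degrees are
      the entries of the first column.
    - The V_i exhaust the irreducible representations, because the squares of
      their degrees already add up to 720 ([irr_comp_surj]).  In particular the
      trivial representation is one of the V_i; it affords the first row, so it
      is the first of them.
*)

Set Implicit Arguments.
Unset Strict Implicit.
Unset Printing Implicit Defensive.

Import Order.TTheory GRing.Theory Num.Theory.
Local Open Scope ring_scope.

(** * Permutations with a given cycle type *)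

Section Blocks.

Variable T : eqType.

Lemma flatten_block_uniq (L : seq (seq T)) c :
  uniq (flatten L) -> c \in L -> uniq c.
Proof.
elim: L => //= c' L IHL; rewrite cat_uniq inE => /and3P[Uc' _ /IHL UL].
by case/predU1P=> [-> | /UL].
Qed.

Lemma next_notin (c : seq T) x : x \notin c -> next c x = x.
Proof. by rewrite next_nth => /negPf->. Qed.

(** [foldr next x L] applies to [x] the product of the cycles in [L]. *)
Lemma foldr_next_notin (L : seq (seq T)) x :
  x \notin flatten L -> foldr next x L = x.
Proof.
elim: L => //= c L IHL; rewrite mem_cat negb_or => /andP[c'x /IHL->].
exact: next_notin.
Qed.

End Blocks.

Section CycleType.

Variable n : nat.

Lemma flatten_disjoint_uniq (L : seq (seq 'I_n)) :
  uniq (flatten L) -> [::] \notin L -> uniq [seq [set y in c] | c <- L].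
Proof.
elim: L => //= c L IHL; rewrite cat_uniq inE negb_or eq_sym.
case/and3P=> Uc cL' UL /andP[nz_c nz_L]; rewrite IHL // andbT.
apply/mapP=> -[c' Lc' /setP eq_cc'].
case: c nz_c eq_cc' cL' {Uc} => // x c _ /(_ x).
rewrite !inE eqxx => c'x /hasP[].
by exists x; rewrite ?mem_head //; apply/flattenP; exists c'.
Qed.

(** Orbits being opaque, cycle types are not computed; they are read off an
    explicit decomposition into cycles. *)
Lemma cycle_type_fcycles (s : 'S_n) (L : seq (seq 'I_n)) :
    {in L, forall c, fcycle s c} -> [::] \notin L ->
    perm_eq (flatten L) (enum 'I_n) ->
  cycle_type s = sort geq (map size L).
Proof.
move=> cycL nzL eqL; have UL : uniq (flatten L).
  by rewrite (perm_uniq eqL) enum_uniq.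
have inL x : exists2 c, c \in L & x \in c.
  by apply/flattenP; rewrite (perm_mem eqL) mem_enum.
have porbitL c x : c \in L -> x \in c -> porbit s x = [set y in c].
  move=> Lc cx; apply/setP=> y; rewrite inE -(fconnect_cycle (cycL c Lc) cx).
  apply/porbitP/idP=> [[i ->] | sxy].
    by rewrite permX fconnect_iter.
  by exists (findex s x y); rewrite permX iter_findex.
have <- : [seq #|pred_of_set X| | X <- [seq [set y in c] | c <- L]] = map size L.
  rewrite -map_comp; apply/eq_in_map=> c Lc /=; rewrite cardsE.
  by apply/card_uniqP/(flatten_block_uniq UL).
rewrite /cycle_type; apply/perm_sortP.
- by move=> i j; exact: leq_total.
- by move=> j i k ij jk; exact: leq_trans jk ij.
- by move=> i j; rewrite andbC => /anti_leq.
apply: perm_map; apply: uniq_perm; rewrite ?enum_uniq ?flatten_disjoint_uniq //.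
move=> X; rewrite mem_enum; apply/imsetP/mapP => [[x _ ->] | [c Lc ->]].
  by have [c Lc cx] := inL x; exists c; rewrite // (porbitL c).
case: c Lc => [/(negP nzL) // | x c Lxc].
by exists x; rewrite // (porbitL (x :: c)) ?mem_head.
Qed.

(** Cut the enumeration of the points into consecutive blocks of the required
    sizes, and permute each block cyclically. *)
Lemma exists_cycle_type (p : seq nat) :
  0%N \notin p -> sumn p = n -> exists s : 'S_n, cycle_type s = sort geq p.
Proof.
move=> nz_p sum_p; pose L := reshape p (enum 'I_n).
have szL : map size L = p by apply: reshapeKl; rewrite size_enum_ord sum_p.
have flatL : flatten L = enum 'I_n.
  by apply: reshapeKr; rewrite size_enum_ord sum_p.
have UL : uniq (flatten L) by rewrite flatL enum_uniq.
pose f x := foldr next x L.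
have f_inj : injective f.
  rewrite /f; elim: (L) UL => [_ x y // | c L' IHL] /=.
  rewrite cat_uniq => /and3P[Uc _ UL'].
  by move=> x y /(can_inj (prev_next Uc))/(IHL UL').
have fL : {in L, forall c, {in c, f =1 next c}}.
  rewrite /f; elim: (L) UL => //= c L' IHL.
  rewrite cat_uniq => /and3P[Uc cL' UL'].
  move=> c1; rewrite inE => /predU1P[-> x cx | L'c1 x c1x].
    rewrite foldr_next_notin //; apply: contra cL' => L'x.
    by apply/hasP; exists x.
  rewrite (IHL UL' c1) // next_notin //; apply: contra cL' => cx.
  apply/hasP; exists (next c1 x) => //.
  by apply/flattenP; exists c1; rewrite ?mem_next.
exists (perm f_inj); rewrite -szL; apply: cycle_type_fcycles; last 2 first.
- by apply: contra nz_p => L0; rewrite -szL (map_f size L0).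
- by rewrite flatL.
move=> c Lc; have Uc : uniq c := flatten_block_uniq UL Lc.
rewrite (eq_in_cycle (P := mem c) (e' := frel (next c))) ?cycle_next //.
by move=> x y cx _ /=; rewrite permE (fL c).
Qed.

Lemma cycle_type1 : cycle_type (1%g : 'S_n) = sort geq (nseq n 1%N).
Proof.
have -> : nseq n 1%N = map size [seq [:: x] | x <- enum 'I_n].
  have size1 (s : seq 'I_n) : map size [seq [:: x] | x <- s] = nseq (size s) 1%N.
    by elim: s => [|x s IHs] /=; rewrite ?IHs.
  by rewrite size1 size_enum_ord.
apply: cycle_type_fcycles; last by rewrite flatten_seq1.
  by move=> _ /mapP[x _ ->]; rewrite /= perm1 eqxx.
by apply/mapP=> -[].
Qed.

End CycleType.

(** * Algebras diagonalized by multiplicative linear forms *)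

(** An algebra of dimension [m] with [m] multiplicative linear forms [chi j], and
    a family [a] dual to them up to nonzero factors: the forms then identify the
    algebra with [K ^ m], and [e i] with the [i]-th unit vector. *)
Section SplitAlgebra.

Variables (K : fieldType) (A : falgType K) (m : nat).
Variables (chi : 'I_m -> {scalar A}) (a : 'I_m -> A) (c : 'I_m -> K).
Hypothesis chiM : forall j x y, chi j (x * y) = chi j x * chi j y.
Hypothesis chi_a : forall i j, chi j (a i) = c i *+ (i == j).
Hypothesis c_neq0 : forall i, c i != 0.
Hypothesis dimA : \dim {:A} = m.

Let e i := (c i)^-1 *: a i.

Let chi_e i j : chi j (e i) = (i == j)%:R.
Proof. by rewrite linearZ /= chi_a mulrnAr mulVf. Qed.

Let chi_sum j (u : 'I_m -> K) : chi j (\sum_i u i *: e i) = u j.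
Proof.
rewrite raddf_sum (bigD1 j) //= linearZ /= chi_e eqxx mulr1.
rewrite big1 ?addr0 // => i /negPf ne_ij.
by rewrite linearZ /= chi_e ne_ij mulr0.
Qed.

Lemma split_alg_expand x : x = \sum_i chi i x *: e i.
Proof.
pose E := [tuple e i | i < m].
have Ei (u : 'I_m -> K) : \sum_i u i *: E`_i = \sum_i u i *: e i.
  by apply: eq_bigr => i _; rewrite -tnth_nth tnth_mktuple.
have freeE : free E.
  by apply/freeP=> u; rewrite Ei => u0 i; rewrite -(chi_sum i u) u0 raddf0.
have basisE : basis_of fullv E.
  by rewrite basisEfree freeE subvf dimA size_tuple /=.
have := coord_basis basisE (memvf x); rewrite Ei => Dx.
by rewrite {1}Dx; apply: eq_bigr => i _; rewrite {2}Dx chi_sum.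
Qed.

(** The joint injectivity of the forms: equations in the algebra, commutativity
    included, can be checked in [K]. *)
Lemma split_alg_eq x y : (forall i, chi i x = chi i y) -> x = y.
Proof.
move=> eq_xy; rewrite [x]split_alg_expand [y]split_alg_expand.
by apply: eq_bigr => i _; rewrite eq_xy.
Qed.

Let mul_e x i : x * e i = chi i x *: e i.
Proof.
apply: split_alg_eq => j; rewrite chiM [RHS]linearZ /= chi_e.
by case: eqP => [->|]; rewrite // !mulr0.
Qed.

Let mulC (x y : A) : x * y = y * x.
Proof. by apply: split_alg_eq => i; rewrite !chiM mulrC. Qed.

Let e_neq0 i : e i != 0.
Proof.
apply/eqP=> e0; have /eqP := chi_e i i.
by rewrite e0 raddf0 eqxx eq_sym oner_eq0.
Qed.

Let aE i : a i = c i *: e i.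
Proof. by rewrite scalerA mulfV ?scale1r. Qed.

Let line_a i : <[a i]>%VS = <[e i]>%VS.
Proof.
apply/eqP; rewrite eqEsubv -!memvE !memvZ ?memv_line // andbT.
by rewrite aE memvZ ?memv_line.
Qed.

Lemma split_alg_dim i : \dim <[a i]> = 1%N.
Proof. by rewrite line_a dim_vline e_neq0. Qed.

Lemma split_alg_subrep i : regular_subrep <[a i]>.
Proof.
move=> x _ /vlineP[k ->].
rewrite line_a aE -2!scalerAr mul_e; do 3!apply: memvZ; exact: memv_line.
Qed.

Lemma split_alg_direct : directv (\sum_i <[a i]>).
Proof.
apply/directv_sum_independent=> us a_us us0 i _.
have us_e j : exists k, us j == k *: e j.
  by have := a_us j isT; rewrite line_a => /vlineP[k ->]; exists k.
pose k j := xchoose (us_e j).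
have Dus j : us j = k j *: e j by apply/eqP/(xchooseP (us_e j)).
rewrite Dus -(chi_sum i k) -(eq_bigr _ (fun j _ => Dus j)) us0 raddf0.
by rewrite scale0r.
Qed.

Lemma split_alg_sum : (\sum_i <[a i]>)%VS = fullv.
Proof.
apply/eqP; rewrite eqEsubv subvf; apply/subvP=> x _.
rewrite [x]split_alg_expand memv_sumr // => i _.
by rewrite line_a memvZ ?memv_line.
Qed.

Lemma split_alg_idempotent f i :
  central_idempotent f -> chi i f = 0 \/ chi i f = 1.
Proof.
case=> _ ff; have /eqP := chiM i f f.
rewrite ff -subr_eq0 -{1}[chi i f]mulr1 -mulrBr mulf_eq0 subr_eq0.
by case/orP=> /eqP; [left | right].
Qed.

(** The values [chi i f] of an idempotent are 0 or 1.  If [chi i f = 1], then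
    [f = e i + (f - e i)] is an orthogonal decomposition, so that a primitive [f]
    is [e i].  Conversely, if [e i = g + h] is one, then [g] and [h] are idempotent
    multiples of [e i]. *)
Lemma split_alg_primitive f :
  central_primitive_idempotent f <-> exists i, f = (c i)^-1 *: a i.
Proof.
have e_idem i : central_idempotent (e i).
  split=> [x|]; first exact: mulC.
  by rewrite mul_e chi_e eqxx scale1r.
split=> [[idf nz_f prim_f] | [i ->]].
  have [i fi1] : exists i, chi i f = 1.
    have [i /eqP|ne1] := pickP (fun i => chi i f == 1); first by exists i.
    case/eqP: nz_f; apply: split_alg_eq => i; rewrite raddf0.
    by case: (split_alg_idempotent i idf) => // /eqP; rewrite ne1.
  have fe : f * e i = e i by rewrite mul_e fi1 scale1r.
  have ef : e i * f = e i by rewrite mulC.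
  exists i; apply/eqP; rewrite -subr_eq0; apply/eqP.
  have idfe : central_idempotent (f - e i).
    split=> [x|]; first exact: mulC.
    rewrite mulrBl !mulrBr ef fe (proj2 (e_idem i)) (proj2 idf).
    by rewrite subrr subr0.
  have [||/eqP|//] := prim_f (e i) (f - e i) (e_idem i) idfe.
  - by rewrite mulrBr ef (proj2 (e_idem i)) subrr.
  - by rewrite addrC subrK.
  by rewrite (negPf (e_neq0 i)).
split; [exact: e_idem | exact: e_neq0 | move=> g h idg idh gh0].
rewrite -/(e i) => Dei.
have eg : g = g * e i by rewrite Dei mulrDr gh0 addr0 (proj2 idg).
have eh : h = h * e i by rewrite Dei mulrDr mulC gh0 add0r (proj2 idh).
have [gi0 | gi1] := split_alg_idempotent i idg; [left | right].
  by rewrite eg mul_e gi0 scale0r.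
by apply: (@addrI _ g); rewrite addr0 -Dei eg mul_e gi1 scale1r.
Qed.

End SplitAlgebra.

(** * Characters as linear forms on the representation ring *)

(** The characters of [G] take values in [C], the coefficients of the ring are in
    [K]: at an element [g] where the irreducible characters have integer values
    [t], these can be read in [K]. *)
Section CharacterValue.

Variables (C : numClosedFieldType) (gT : finGroupType) (G : {group gT}).
Variables (K : fieldType) (g : gT) (t : irrep C G -> int).
Hypothesis Gg : g \in G.
Hypothesis tr_g : forall w, \tr (irr_repr w g) = (t w)%:~R.

Definition char_value (x : repr_ring C G K) : K := \sum_w x w * (t w)%:~R.

Lemma char_value_scalar : scalar char_value.
Proof.
move=> k x y; rewrite /char_value mulr_sumr -big_split.
by apply: eq_bigr => w _; rewrite !ffunE mulrDl mulrA.
Qed.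

(** The decomposition of [rG] into irreducibles gives an identity in [C] between
    integers, which is first pulled back to [int] and then mapped to [K]. *)
Lemma char_value_class n (rG : mx_representation C G n) (z : int) :
  \tr (rG g) = z%:~R -> char_value (repr_ring_class K rG) = z%:~R.
Proof.
rewrite mxtrace_repr_mult // => Dz.
have ->: z = \sum_w (repr_mult rG w)%:Z * t w.
  apply: (@intr_inj C); rewrite -Dz rmorph_sum; apply: eq_bigr => w _.
  by rewrite tr_g rmorphM.
by rewrite rmorph_sum; apply: eq_bigr => w _; rewrite ffunE rmorphM.
Qed.

HB.instance Definition _ :=
  GRing.isLinear.Build K (repr_ring C G K) K *%R char_value char_value_scalar.

Lemma char_valueM x y : char_value (x * y) = char_value x * char_value y.
Proof.
rewrite [char_value (x * y)]raddf_sum mulr_suml; apply: eq_bigr => v _.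
rewrite raddf_sum mulr_sumr; apply: eq_bigr => w _.
rewrite [LHS]linearZ /=.
have -> : char_value (repr_ring_class K (prod_repr (irr_repr v) (irr_repr w)))
    = (t v * t w)%:~R.
  by apply: char_value_class; rewrite mxtrace_prod !tr_g -intrM.
by rewrite intrM mulrACA.
Qed.

End CharacterValue.

Lemma dim_repr_ring (C : numClosedFieldType) (gT : finGroupType)
  (G : {group gT}) (K : fieldType) : \dim {:repr_ring C G K} = #|irrep C G|.
Proof. by rewrite dimvf; exact: muln1. Qed.

(** * Complete families of irreducible representations *)

Section IrrComp.

Variables (C : numClosedFieldType) (gT : finGroupType) (G : {group gT}).

Lemma num_pchar'_group : ([pchar C]^'.-group G)%g.
Proof. by apply/pgroupP=> p _ _; rewrite inE /= pchar_num. Qed.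

Lemma irr_comp_rsimP n (rG : mx_representation C G n) :
  mx_irreducible rG -> mx_rsim rG (irr_repr (irr_comp (irrep C G) rG)).
Proof. exact: rsim_irr_comp_pchar num_pchar'_group _ _. Qed.

(** The squares of the degrees of all irreducible representations add up to
    [#|G|], and every degree is positive. *)
Lemma irr_comp_surj m (d : 'I_m -> nat)
    (V : forall i, mx_representation C G (d i)) :
    (forall i, mx_irreducible (V i)) ->
    injective (fun i => irr_comp (irrep C G) (V i)) ->
    (\sum_i d i ^ 2)%N = #|G| ->
  forall w, exists i, irr_comp (irrep C G) (V i) = w.
Proof.
move=> irrV; set f := fun i => _ => inj_f sum_d w.
suffices /imsetP[i _ ->]: w \in f @: [set: 'I_m] by exists i.
have deg_f i : irr_degree (f i) = d i by case: (irr_comp_rsimP (irrV i)).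
have := sum_irr_degree_pchar (irrep C G) num_pchar'_group
          (@group_closure_closed_field C gT G).
rewrite (bigID (mem (f @: [set: 'I_m]))) /= big_imset => [|i j _ _ /inj_f //].
rewrite -sum_d (eq_bigl xpredT) => [|i]; last by rewrite inE.
rewrite (eq_bigr (fun i => d i ^ 2)%N) => [|i _]; last by rewrite deg_f.
move/eqP; rewrite -[X in _ == X]addn0 eqn_add2l sum_nat_eq0 => /forall_inP/(_ w).
by case: (w \in _) => // /(_ isT); rewrite expn_eq0 eqn0Ngt irr_degree_gt0.
Qed.

End IrrComp.

(** * The character table of S_6 *)

Local Notation S6_value i j := (nth 0 (nth [::] S6_character_table i) j).

Definition S6_centralizers : seq nat :=
  [:: 720; 48; 6; 48; 8; 6; 16; 18; 5; 8; 18]%N.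

Lemma S6_table_orthogonal (j k : 'I_11) :
  \sum_(i < 11) S6_value i j * S6_value i k
    = (nth 1%N S6_centralizers j)%:Z *+ (j == k).
Proof.
(* The products of columns, in a form that evaluates. *)
pose dot j k := foldr (fun i x => S6_value i j * S6_value i k + x) 0 (iota 0 11).
have -> : \sum_(i < 11) S6_value i j * S6_value i k = dot j k.
  rewrite -(big_mkord xpredT (fun i => S6_value i j * S6_value i k)).
  rewrite /dot /index_iota; elim: (iota _ _) => [|i s IHs].
    by rewrite big_nil.
  by rewrite big_cons IHs.
have /allP/(_ j) : all (fun j => all (fun k =>
    dot j k == (nth 1%N S6_centralizers j)%:Z *+ (j == k)) (iota 0 11)) (iota 0 11).
  by vm_compute.
rewrite mem_iota => /(_ (ltn_ord j))/allP/(_ k).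
by rewrite mem_iota => /(_ (ltn_ord k))/eqP.
Qed.

Lemma S6_class_repr : exists g : 'I_11 -> 'S_6,
  forall j : 'I_11, cycle_type (g j) = nth [::] S6_cycle_types j.
Proof.
have g_ex (j : 'I_11) :
    exists s : 'S_6, cycle_type s == nth [::] S6_cycle_types j.
  pose ok p := [&& 0%N \notin p, sumn p == 6 & sort geq p == p].
  have /(all_nthP [::])/(_ j (ltn_ord j)) : all ok S6_cycle_types by vm_compute.
  case/and3P=> nz /eqP sum6 /eqP <-.
  by have [s <-] := exists_cycle_type nz sum6; exists s.
by exists (fun j => xchoose (g_ex j)) => j; apply/eqP/(xchooseP (g_ex j)).
Qed.

(** The elements alpha_j are the columns of the character table.  The equation
    only involves the module structure, and is stated in an arbitrary module to
    keep the normalization away from the representation ring. *)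
Lemma S6_column_sum (K : fieldType) (M : lmodType K)
    (x0 x1 x2 x3 x4 x5 x6 x7 x8 x9 x10 : M) (j : 'I_11) :
  \sum_(i < 11) (S6_value i j)%:~R
      *: nth 0 [:: x0; x1; x2; x3; x4; x5; x6; x7; x8; x9; x10] i
  = nth 0 [:: x0 + x1 + 5 *: x2 + 5 *: x3 + 9 *: x4 + 9 *: x5
          + 10 *: x6 + 10 *: x7 + 5 *: x8 + 5 *: x9 + 16 *: x10;
        x0 - x1 + 3 *: x2 - 3 *: x3 + 3 *: x4 - 3 *: x5
          + 2 *: x6 - 2 *: x7 + x8 - x9;
        x0 - x1 - x6 + x7 + x8 - x9;
        x0 - x1 - x2 + x3 + 3 *: x4 - 3 *: x5
          - 2 *: x6 + 2 *: x7 - 3 *: x8 + 3 *: x9;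
        x0 - x1 + x2 - x3 - x4 + x5 - x8 + x9;
        x0 - x1 - x2 + x3 + x6 - x7;
        x0 + x1 + x2 + x3 + x4 + x5 - 2 *: x6 - 2 *: x7 + x8 + x9;
        x0 + x1 + 2 *: x2 + 2 *: x3 + x6 + x7 - x8 - x9 - 2 *: x10;
        x0 + x1 - x4 - x5 + x10;
        x0 + x1 - x2 - x3 + x4 + x5 - x8 - x9;
        x0 + x1 - x2 - x3 + x6 + x7 + 2 *: x8 + 2 *: x9 - 2 *: x10 ] j.
Proof.
rewrite !big_ord_recl big_ord0 /=; case: j => j.
do 11?[case: j => [_ | j] /=]; last by [].
all: by rewrite !(mulrNz, mulr0z, mulr1z, scaleNr, scale0r, scale1r,
                  addr0, add0r, addrA).
Qed.

Section Rows.

Variable C : numClosedFieldType.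
Local Notation repr n := (mx_representation C [set: 'S_6] n).

Lemma affords_S6_row_rsim i n1 n2 (rG1 : repr n1) (rG2 : repr n2) :
  mx_rsim rG1 rG2 -> affords_S6_row i rG1 -> affords_S6_row i rG2.
Proof.
move=> sim12 row_i j s s_j.
by rewrite -(mxtrace_rsim sim12) ?inE // (row_i j).
Qed.

(** The rows of the table are distinct, and every class occurs. *)
Lemma affords_S6_row_inj (i j : 'I_11) n (rG : repr n) :
  affords_S6_row i rG -> affords_S6_row j rG -> i = j.
Proof.
move=> row_i row_j; have [g g_type] := S6_class_repr.
have szT : size S6_character_table = 11 by [].
have szr (k : 'I_11) : size (nth [::] S6_character_table k) = 11.
  have /(all_nthP [::])/(_ k (ltn_ord k))/eqP :
    all (fun r => size r == 11) S6_character_table by [].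
  by [].
apply/val_inj/eqP; rewrite /= -(nth_uniq [::] (s := S6_character_table)) ?szT //.
apply/eqP/(@eq_from_nth _ 0) => [|k]; first by rewrite !szr.
rewrite szr => lt_k; apply: (@intr_inj C).
have gk := g_type (Ordinal lt_k).
by rewrite -(row_i (Ordinal lt_k) _ gk) -(row_j (Ordinal lt_k) _ gk).
Qed.

Lemma affords_S6_row_degree (i : 'I_11) n (rG : repr n) :
  affords_S6_row i rG -> n%:Z = S6_value i 0.
Proof.
move=> row_i; apply: (@intr_inj C).
by rewrite -(row_i ord0 1%g) ?cycle_type1 // repr_mx1 mxtrace1.
Qed.

Lemma trivial_affords_S6_row0 : affords_S6_row 0 (trivial_repr C [set: 'S_6]).
Proof.
move=> j s _; rewrite mxtrace1.
have /(all_nthP 0)/(_ j (ltn_ord j))/eqP -> :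
  all (pred1 1) (nth [::] S6_character_table 0) by [].
by [].
Qed.

(** The degrees form the column of the identity, whose square is 720 by
    orthogonality. *)
Lemma S6_sum_sqr_degree (d : 'I_11 -> nat) :
  (forall i : 'I_11, (d i)%:Z = S6_value i 0) -> (\sum_i d i ^ 2)%N = 720.
Proof.
move=> Dd; apply/eqP; rewrite -eqz_nat; apply/eqP.
transitivity (\sum_(i < 11) S6_value i (@ord0 10) * S6_value i (@ord0 10)).
  rewrite -natz natr_sum; apply: eq_bigr => i _.
  by rewrite natrX natz Dd expr2.
by rewrite S6_table_orthogonal.
Qed.

End Rows.

(** * The decomposition of the representation ring of S_6 *)

Theorem proposition11 (R : realType) (F : fieldType)
    (charF : [pchar F] =i pred0)
    (splitF : group_splitting_field F [set: 'S_6])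
    (d : 'I_11 -> nat)
    (V : forall i : 'I_11, mx_representation R[i] [set: 'S_6] (d i))
    (V_irr : forall i : 'I_11, mx_irreducible (V i))
    (V_table : forall i : 'I_11, affords_S6_row i (V i)) :
  let x1 := repr_ring_class F (V (inord 1)) in
  let x2 := repr_ring_class F (V (inord 2)) in
  let x3 := repr_ring_class F (V (inord 3)) in
  let x4 := repr_ring_class F (V (inord 4)) in
  let x5 := repr_ring_class F (V (inord 5)) in
  let x6 := repr_ring_class F (V (inord 6)) in
  let x7 := repr_ring_class F (V (inord 7)) in
  let x8 := repr_ring_class F (V (inord 8)) in
  let x9 := repr_ring_class F (V (inord 9)) in
  let x10 := repr_ring_class F (V (inord 10)) in
  let alpha (i : 'I_11) : repr_ring R[i] [set: 'S_6] F :=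
    nth 0 [:: 1 + x1 + 5 *: x2 + 5 *: x3 + 9 *: x4 + 9 *: x5
          + 10 *: x6 + 10 *: x7 + 5 *: x8 + 5 *: x9 + 16 *: x10;
        1 - x1 + 3 *: x2 - 3 *: x3 + 3 *: x4 - 3 *: x5
          + 2 *: x6 - 2 *: x7 + x8 - x9;
        1 - x1 - x6 + x7 + x8 - x9;
        1 - x1 - x2 + x3 + 3 *: x4 - 3 *: x5
          - 2 *: x6 + 2 *: x7 - 3 *: x8 + 3 *: x9;
        1 - x1 + x2 - x3 - x4 + x5 - x8 + x9;
        1 - x1 - x2 + x3 + x6 - x7;
        1 + x1 + x2 + x3 + x4 + x5 - 2 *: x6 - 2 *: x7 + x8 + x9;
        1 + x1 + 2 *: x2 + 2 *: x3 + x6 + x7 - x8 - x9 - 2 *: x10;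
        1 + x1 - x4 - x5 + x10;
        1 + x1 - x2 - x3 + x4 + x5 - x8 - x9;
        1 + x1 - x2 - x3 + x6 + x7 + 2 *: x8 + 2 *: x9 - 2 *: x10 ]
    i in
  let e (i : 'I_11) : repr_ring R[i] [set: 'S_6] F :=
    (nth 1%N [:: 720; 48; 6; 48; 8; 6; 16; 18; 5; 8; 18]%N i)%:R^-1 *: alpha i in
  [/\ repr_ring_class F (V ord0) = 1,
      [/\ forall i, \dim <[alpha i]> = 1%N,
          forall i, regular_subrep <[alpha i]>,
          directv (\sum_(i < 11) <[alpha i]>)
        & (\sum_(i < 11) <[alpha i]>)%VS = fullv]
    & forall f : repr_ring R[i] [set: 'S_6] F,
        central_primitive_idempotent f <-> exists i, f = e i].
Proof.
(* The V_i are all the irreducible representations, each one once. *)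
pose irr i := irr_comp (irrep R[i] [set: 'S_6]) (V i).
have irr_inj : injective irr.
  move=> i j eq_ij; apply: affords_S6_row_inj (V_table j).
  apply: affords_S6_row_rsim (V_table i).
  apply: mx_rsim_trans (irr_comp_rsimP (V_irr i)) _; rewrite -/(irr i) eq_ij.
  exact: mx_rsim_sym (irr_comp_rsimP (V_irr j)).
have irr_surj : forall w, exists i, irr i = w.
  apply: irr_comp_surj => //.
  rewrite (S6_sum_sqr_degree (fun i => affords_S6_row_degree (V_table i))).
  by rewrite cardsT card_Sn.
have inv_ex w : exists i, irr i == w.
  by have [i <-] := irr_surj w; exists i.
pose inv w := xchoose (inv_ex w).
have invK w : irr (inv w) = w by apply/eqP/(xchooseP (inv_ex w)).
have V0 : repr_ring_class F (V ord0) = 1.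
  (* The trivial representation is some V_i, and it affords row 0. *)
  pose triv := trivial_repr R[i] [set: 'S_6].
  have irr_triv : mx_irreducible triv by exact/mx_abs_irrW/linear_mx_abs_irr.
  have [i Di] := irr_surj (irr_comp (irrep _ _) triv).
  have simV : mx_rsim (V i) triv.
    apply: mx_rsim_trans (irr_comp_rsimP (V_irr i)) _; rewrite -/(irr i) Di.
    exact: mx_rsim_sym (irr_comp_rsimP irr_triv).
  have <- : i = ord0.
    apply: affords_S6_row_inj (affords_S6_row_rsim simV (V_table i)) _.
    exact: trivial_affords_S6_row0.
  by rewrite (repr_ring_class_rsim F simV).
have [g g_type] := S6_class_repr.
(* Column j of the table, indexed by the irreducible representations. *)
pose t j w := S6_value (inv w) j.
have tr_g (j : 'I_11) w : \tr (irr_repr w (g j)) = (t j w)%:~R.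
  rewrite -(V_table (inv w) j (g j) (g_type j)).
  rewrite (mxtrace_rsim (irr_comp_rsimP (V_irr (inv w)))) ?inE //.
  by rewrite -/(irr _) invK.
pose chi (j : 'I_11) : {scalar repr_ring R[i] [set: 'S_6] F} :=
  char_value (t j).
have chi_V i j : chi j (repr_ring_class F (V i)) = (S6_value i j)%:~R.
  by apply: (char_value_class F (in_setT (g j)) (tr_g j)); exact: V_table.
move=> x1 x2 x3 x4 x5 x6 x7 x8 x9 x10 alpha e.
have DV (i : 'I_11) : repr_ring_class F (V i)
    = nth 0 [:: 1; x1; x2; x3; x4; x5; x6; x7; x8; x9; x10] i.
  rewrite -[i in LHS]inord_val; case: i => i /=.
  do 11?[case: i => [_ | i] //=].
  by rewrite -V0 (_ : inord 0 = ord0) //; apply/val_inj; rewrite /= inordK.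
have Dalpha j :
    alpha j = \sum_(i < 11) (S6_value i j)%:~R *: repr_ring_class F (V i).
  by under eq_bigr do rewrite DV; rewrite S6_column_sum.
pose c (i : 'I_11) : F := (nth 1%N S6_centralizers i)%:R.
have chi_alpha i j : chi j (alpha i) = c i *+ (i == j).
  rewrite Dalpha raddf_sum.
  transitivity ((\sum_(k < 11) S6_value k i * S6_value k j)%:~R : F).
    rewrite rmorph_sum; apply: eq_bigr => k _.
    by rewrite [LHS]linearZ /= chi_V -intrM.
  by rewrite S6_table_orthogonal rmorphMn.
have c_neq0 i : c i != 0.
  have /pcharf0P-> := charF.
  by have /(all_nthP 1%N)/(_ i (ltn_ord i)) :
    all (predC1 0%N) S6_centralizers by [].
have chiM j x y : chi j (x * y) = chi j x * chi j y.
  exact: char_valueM (in_setT (g j)) (tr_g j) x y.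
have dimF : \dim {: repr_ring R[i] [set: 'S_6] F} = 11.
  rewrite dim_repr_ring -[RHS]card_ord; apply: bij_eq_card (inv) _.
  by exists irr => // i; apply: irr_inj; rewrite invK.
split=> //; last exact: split_alg_primitive chiM chi_alpha c_neq0 dimF.
split.
- exact: split_alg_dim chi_alpha c_neq0.
- exact: split_alg_subrep chiM chi_alpha c_neq0 dimF.
- exact: split_alg_direct chi_alpha c_neq0.
- exact: split_alg_sum chi_alpha c_neq0 dimF.
Qed.
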